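(* Let $k\ge 1$ and $n\ge 1$ be integers. The number of signed permutations in $S^{\mathrm{B}}_n$ that globally avoid both the pattern $132$ and the decreasing pattern $(k+1)k\cdots 21\in S_{k+1}$ is \[ \sum_{j=1}^{k}\binom{n-1}{\lfloor (j-1)/2\rfloor}. \]
   Context: Notation: $[n]=\{1,\dots,n\}$ and $[\pm n]=\{\pm1,\dots,\pm n\}$. Elements of the symmetric group $S_m$ are written in one-line notation $p(1)\cdots p(m)$. $S^{\mathrm{B}}_n$ is the set (group) of signed permutations of size $n$, i.e. bijections $w:[\pm n]\to[\pm n]$ with $w(-x)=-w(x)$ for all $x\in[n]$. Global avoidance: for $p\in S_m$, a signed permutation $w\in S^{\mathrm{B}}_n$ globally contains $p$ if there are indices $i_1<\cdots<i_m$ in $[\pm n]$ (in the usual order of the integers) such that $w(i_1)\cdots w(i_m)$ is order-isomorphic to $p$; otherwise $w$ globally avoids $p$. *)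

(* Defs.v *)
From mathcomp Require Import all_boot all_order all_fingroup all_algebra.

Set Implicit Arguments.
Unset Strict Implicit.
Unset Printing Implicit Defensive.

Import Order.TTheory GRing.Theory Num.Theory.

(* pm n is the set [±n] = {±1, ..., ±n} of integers, as a finite subtype of
   int; val : pm n -> int gives the underlying integer. *)
Definition pm_seq (n : nat) : seq int :=
  ([seq - i%:Z | i <- iota 1 n] ++ [seq i%:Z | i <- iota 1 n])%R.

Notation pm n := (seq_sub (pm_seq n)).

Lemma mem_pm_seq (n : nat) (x : int) :
  (x \in pm_seq n) = (1 <= `|x| <= n)%N.
Proof.
rewrite mem_cat; apply/orP/idP.
  by case=> /mapP [i]; rewrite mem_iota add1n ltnS => hi ->; rewrite ?abszN.
case: (intP x) => [|m|m] hm; first by [].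
  by right; apply/mapP; exists m.+1; rewrite // mem_iota add1n ltnS.
by left; apply/mapP; exists m.+1; rewrite // mem_iota add1n ltnS; rewrite abszN in hm.
Qed.

(* The property w(-x) = -w(x), where y ranges over the elements -x of [±n]. *)
Definition signed_perm (n : nat) (w : {perm pm n}) : bool :=
  [forall x, forall y,
     (val y == - val x)%R ==> (val (w y) == - val (w x))%R].

Definition signed_perms (n : nat) : {set {perm pm n}} :=
  [set w | signed_perm w].

Definition globally_contains (n m : nat) (w : {perm pm n}) (p : 'S_m) : bool :=
  [exists i : {ffun 'I_m -> pm n},
     [forall a : 'I_m, forall b : 'I_m,
        (a < b)%N ==> (val (i a) < val (i b))%R]
     && [forall a : 'I_m, forall b : 'I_m,
        (val (w (i a)) < val (w (i b)))%R == (p a < p b)%N]].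

Definition globally_avoids (n m : nat) (w : {perm pm n}) (p : 'S_m) : bool :=
  ~~ globally_contains w p.

(* One-line notation p(1) ... p(m): the elements of 'I_m are numbered from 0. *)
Definition one_line (m : nat) (p : 'S_m) : seq nat :=
  [seq (p i).+1 | i <- enum 'I_m].

Definition pattern132 : 'S_3 := tperm (inord 1) (inord 2).

Definition decreasing_pattern (m : nat) : 'S_m := perm (@rev_ord_inj m).

Lemma one_line_pattern132 : one_line pattern132 = [:: 1; 3; 2].
Proof.
rewrite /one_line enum_ordSl enum_ordSl enum_ordSl enum_ord0 /= !permE /=.
by rewrite -!val_eqE /= !inordK //=.
Qed.

Lemma one_line_decreasing (k : nat) :
  one_line (decreasing_pattern k.+1) = rev (iota 1 k.+1).
Proof.
apply: (@eq_from_nth _ 0); first by rewrite size_map size_enum_ord size_rev size_iota.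
rewrite size_map size_enum_ord => i hi.
rewrite (nth_map ord0) ?size_enum_ord // nth_rev ?size_iota //.
by rewrite nth_iota ?subSS ?ltnS ?leq_subr // permE [val _]/= nth_enum_ord //.
Qed.

(* Main.v *)
(* Read w as a permutation s of {0, ..., 2n-1}, centrally symmetric in the sense
   that s commutes with i |-> 2n-1-i. Central symmetry turns an occurrence of 132
   into one of 213, so s avoids both; this forces s(x) < s(y), for x < y, exactly
   when there is no descent between x and y. Hence s is a decreasing sequence of
   increasing runs: it is determined by its set of descents, which may be any
   symmetric set of gaps, and its longest decreasing subsequence has as many
   entries as there are runs. With n = m+1, a symmetric set of 2c (resp. 2c+1)
   gaps is given by c of the m gaps to the right of the central one, so j runs
   occur for 'C(m, (j-1)/2) permutations. *)
Require Import Defs.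
From mathcomp Require Import all_boot all_order all_fingroup all_algebra zify.
Set Implicit Arguments.
Unset Strict Implicit.
Unset Printing Implicit Defensive.
Import Order.TTheory.

(** * Ranks in a finite set totally ordered by an injective key *)

Section Rank.
Variables (T : finType) (d : Order.disp_t) (V : orderType d) (key : T -> V).
Hypothesis key_inj : injective key.

Definition rank (x : T) : nat := #|[set y | (key y < key x)%O]|.

Lemma rank_lt (x y : T) : (rank x < rank y) = (key x < key y)%O.
Proof.
have mono u v : (key u < key v)%O -> rank u < rank v.
  move=> uv; apply: proper_card; apply/properP; split.
    by apply/subsetP => z; rewrite !inE => /lt_trans; apply.
  by exists u; rewrite !inE ?ltxx.
case: (ltgtP (key x) (key y)) => [/mono //|/mono|/key_inj ->]; last by rewrite ltnn.
by move=> /ltnW; rewrite leqNgt => /negbTE.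
Qed.

Lemma rank_inj : injective rank.
Proof.
move=> x y e; apply: key_inj; apply/eqP; rewrite eq_le !leNgt -!rank_lt.
by rewrite e ltnn.
Qed.

Lemma rank_bound (x : T) : rank x < #|T|.
Proof.
rewrite -cardsT; apply: proper_card; apply/properP; split; first exact: subsetT.
by exists x; rewrite !inE ?ltxx.
Qed.

(** As [r] reverses the order, it matches the elements below [r x] with those above [x]; these, the
    elements below [x], and [x] itself partition [T]. *)
Lemma rank_reverse (r : T -> T) (x : T) :
  involutive r -> (forall u v, (key (r u) < key (r v))%O = (key v < key u)%O) ->
  (rank (r x) + rank x).+1 = #|T|.
Proof.
move=> rK rkey.
have -> : rank (r x) = #|[set y | (key x < key y)%O]|.
  rewrite /rank -(card_preimset _ (inv_inj rK)); apply: eq_card => y.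
  by rewrite !inE rkey.
rewrite addnC -addnS -cardsT.
rewrite -(cardsID [set y | (key y < key x)%O] setT) setTI; congr (_ + _).
rewrite [RHS](cardsD1 x) !inE ltxx add1n; congr _.+1; apply: eq_card => y.
rewrite !inE andbT -leNgt lt_def; congr (_ && _).
by rewrite (inj_eq key_inj).
Qed.

End Rank.

(** * Counting descents between two positions of a word *)

Section DescentCount.
Variables (N : nat) (f : nat -> nat).
Hypothesis f_inj : {in [pred i | i < N] &, injective f}.

Definition ndes (x y : nat) : nat := \sum_(x <= i < y) (f i.+1 < f i).

Lemma ndes_cat (x y z : nat) : x <= y <= z -> ndes x z = ndes x y + ndes y z.
Proof. by case/andP=> xy yz; rewrite /ndes (@big_cat_nat _ _ _ y). Qed.

Lemma ndesS (x : nat) : ndes 0 x.+1 = ndes 0 x + (f x.+1 < f x).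
Proof. by rewrite /ndes big_nat_recr. Qed.

Lemma ndes0_lt (x y : nat) : x < y < N -> ndes x y = 0 -> f x < f y.
Proof.
case/andP; elim: y => // y IH; rewrite ltnS => xy yN.
rewrite {1}/ndes big_nat_recr //= => /eqP; rewrite addn_eq0 => /andP [/eqP e0].
have fy : f y != f y.+1.
  by apply/eqP => /f_inj; rewrite !inE => /(_ (ltnW yN) yN) /n_Sn.
rewrite eqb0 -leqNgt leq_eqVlt (negbTE fy) /= => lt.
move: xy; rewrite leq_eqVlt => /orP [/eqP -> //|xy].
exact: ltn_trans (IH xy (ltnW yN) e0) lt.
Qed.

(** Discrete intermediate values: the count starts at 0 and grows by at most 1 per position. *)
Lemma ndes_surj (x k : nat) : k <= ndes 0 x -> exists2 y, y <= x & ndes 0 y = k.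
Proof.
elim: x => [|x IH].
  by rewrite {1}/ndes big_geq // leqn0 => /eqP ->; exists 0; rewrite // /ndes big_geq.
case: (leqP k (ndes 0 x)) => [/IH [y yx <-] _|lt]; first by exists y => //; apply: leqW.
by move=> le; exists x.+1 => //; move: le; rewrite ndesS; lia.
Qed.

Hypothesis f132 : forall x y z, x < y < z -> z < N -> ~~ (f x < f z < f y).
Hypothesis f213 : forall x y z, x < y < z -> z < N -> ~~ (f y < f x < f z).

(** Suppose [f x < f y] with a descent at [i] in between. If [f i < f y], then [i], [i.+1], [y] form
    a 213; otherwise [f y < f i], and [x], [i], [y] form a 132. *)
Lemma lt_ndes0 (x y : nat) : x < y < N -> (f x < f y) = (ndes x y == 0).
Proof.
move=> xyN; apply/idP/eqP; last exact: ndes0_lt.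
move=> fxy; apply/eqP; rewrite sum_nat_seq_eq0; apply/allP => i.
rewrite mem_index_iota => /= xiy; rewrite eqb0 -leqNgt leqNgt; apply/negP => fi.
have fiy : f y < f i.
  rewrite ltnNge leq_eqVlt; apply/negP => /orP [/eqP /f_inj|fiy].
    by rewrite !inE => e; have := e ltac:(lia) ltac:(lia); lia.
  have [e|ne] := eqVneq i.+1 y; first by move: fi; rewrite e; lia.
  have := @f213 i i.+1 y ltac:(lia) ltac:(lia); lia.
have [e|ne] := eqVneq i x; first by subst i; lia.
have := @f132 x i y ltac:(lia) ltac:(lia); lia.
Qed.

End DescentCount.

(** * Patterns and central symmetry for permutations of an initial segment *)

Definition contains (N m : nat) (s : 'S_N) (p : 'S_m) : bool :=
  [exists i : {ffun 'I_m -> 'I_N},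
     [forall a : 'I_m, forall b : 'I_m, (a < b) ==> (i a < i b)]
     && [forall a : 'I_m, forall b : 'I_m, (s (i a) < s (i b)) == (p a < p b)]].

Lemma containsP (N m : nat) (s : 'S_N) (p : 'S_m) :
  reflect (exists2 i : 'I_m -> 'I_N, {homo i : a b / a < b}
             & forall a b, (s (i a) < s (i b)) = (p a < p b))
          (contains s p).
Proof.
apply: (iffP existsP) => [[i /andP [/'forall_forallP h1 /'forall_forallP h2]]|[i h1 h2]].
  exists i => [a b|a b]; first by apply/implyP.
  exact: (eqP (h2 a b)).
exists (finfun i); apply/andP; split; apply/'forall_forallP => a b; rewrite !ffunE.
  exact/implyP/h1.
by rewrite h2.
Qed.

Definition centrally_symmetric (N : nat) (s : 'S_N) : bool :=
  [forall x, s (rev_ord x) == rev_ord (s x)].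

Lemma card_ltn_ord (N : nat) (k : 'I_N) : #|[set i : 'I_N | i < k]| = k.
Proof.
rewrite cardsE -sum1_card (big_ord_narrow (F := fun=> 1) (ltnW (ltn_ord k))).
by rewrite sum1_card card_ord.
Qed.

(** * Centrally symmetric 132-avoiders and their descents *)

Section Word.
Variables (M : nat).
Implicit Types s t : 'S_M.+1.

(** Being total on [nat], it allows positions such as [i.+1] and [M - i] without bound proofs;
    beyond [M], [inord] falls back to position 0. *)
Definition word s (i : nat) : nat := s (inord i).

Lemma word_ord s (x : 'I_M.+1) : word s x = s x.
Proof. by rewrite /word inord_val. Qed.

Lemma word_le s i : word s i <= M.
Proof. by rewrite -ltnS /word. Qed.

Lemma word_inj s : {in [pred i | i < M.+1] &, injective (word s)}.
Proof.
move=> i j; rewrite !inE => iM jM /val_inj /perm_inj /(congr1 val) /=.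
by rewrite !inordK.
Qed.

Lemma word_rev s i : centrally_symmetric s -> i <= M -> word s (M - i) = M - word s i.
Proof.
move=> /forallP sym iM; have /eqP/(congr1 val) := sym (inord i).
rewrite /= subSS -/(word s i) => <-; rewrite /word; congr (val (s _)).
by apply: val_inj; rewrite /= !inordK ?subSS // ltnS ?leq_subr.
Qed.

Lemma word_132 s : reflect
  (forall x y z, x < y < z -> z <= M -> ~~ (word s x < word s z < word s y))
  (~~ contains s pattern132).
Proof.
have p0 : pattern132 ord0 = ord0.
  by rewrite permE /= -!val_eqE /= !inordK.
have p1 : pattern132 (inord 1) = inord 2 by rewrite permE /= eqxx.
have p2 : pattern132 (inord 2) = inord 1.
  by rewrite permE /= -!val_eqE /= !inordK.
have [e1 e2] : (inord 1 : 'I_3) = 1 :> nat /\ (inord 2 : 'I_3) = 2 :> nat.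
  by rewrite !inordK.
apply: (iffP idP) => [/containsP avoid x y z /andP [xy yz] zM|h].
  apply/negP => /andP [xz zy]; apply: avoid.
  pose i (a : 'I_3) : 'I_M.+1 := inord (nth 0 [:: x; y; z] a).
  have iE (a : 'I_3) : i a = nth 0 [:: x; y; z] a :> nat.
    by rewrite inordK //; case: a => [[|[|[|a]]]] //= _; lia.
  exists i => a b.
    rewrite !iE; case: a b => [[|[|[|a]]] ha] //= [[|[|[|b]]] hb] //=; lia.
  rewrite -!word_ord !iE.
  have p_eq (c : 'I_3) : pattern132 c = nth 0 [:: 0; 2; 1] c :> nat.
    case: c => [[|[|[|c]]] hc] //.
    - by rewrite [Ordinal _](_ : _ = ord0) ?p0 //; apply: val_inj.
    - by rewrite [Ordinal _](_ : _ = inord 1) ?p1 ?e1 ?e2 //; apply: val_inj.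
    - by rewrite [Ordinal _](_ : _ = inord 2) ?p2 ?e1 ?e2 //; apply: val_inj.
  rewrite !p_eq; case: a b => [[|[|[|a]]] ha] //= [[|[|[|b]]] hb] //=; lia.
apply/negP => /containsP [i inc pat].
have := h (i ord0) (i (inord 1)) (i (inord 2)).
rewrite !word_ord !inc ?e1 ?e2 // !pat p0 p1 p2 e1 e2 -ltnS ltn_ord.
by move=> /(_ isT isT).
Qed.

(** The half turn of the permutation diagram sends a 213 at [x], [y], [z] to a 132 at [M - z],
    [M - y], [M - x]. *)
Lemma word_213 s : centrally_symmetric s -> ~~ contains s pattern132 ->
  forall x y z, x < y < z -> z <= M -> ~~ (word s y < word s x < word s z).
Proof.
move=> sym /word_132 av x y z xyz zM.
have := av (M - z) (M - y) (M - x) ltac:(lia) ltac:(lia).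
rewrite !word_rev //; try lia.
by move: (word_le s x) (word_le s y) (word_le s z); lia.
Qed.

(* The longest decreasing subsequence takes one entry from each maximal increasing run. *)
Lemma contains_decreasing s k :
  centrally_symmetric s -> ~~ contains s pattern132 ->
  contains s (decreasing_pattern k.+1) = (k <= ndes (word s) 0 M).
Proof.
move=> sym av.
have lt0 x y (xyM : x < y < M.+1) := lt_ndes0 (@word_inj s)
  (elimT (word_132 s) av) (word_213 sym av) xyM.
have decE (a b : 'I_k.+1) :
    (decreasing_pattern k.+1 a < decreasing_pattern k.+1 b) = (b < a).
  by rewrite !permE /=; move: (ltn_ord a) (ltn_ord b); lia.
apply/containsP/idP => [[i inc pat]|kM].
  (* Entries in decreasing order are separated by a descent, so they lie in different runs. *)
  have step (a b : 'I_k.+1) :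
      a < b -> ndes (word s) 0 (i a) < ndes (word s) 0 (i b).
    move=> ab; have iab := inc _ _ ab; rewrite (@ndes_cat _ 0 (i a) (i b)) ?(ltnW iab) //.
    have := lt0 (i a) (i b); rewrite iab !word_ord pat decE => /(_ (ltn_ord _)).
    by rewrite ltnNge (ltnW ab) /=; lia.
  have ind c (ck : c < k.+1) : c <= ndes (word s) 0 (i (Ordinal ck)).
    elim: c ck => // c IH ck; apply: leq_ltn_trans (IH (ltnW ck)) _.
    exact: step.
  apply: leq_trans (ind k (ltnSn k)) _.
  rewrite (@ndes_cat _ 0 (i (Ordinal (ltnSn k))) M) ?leq_addr //=.
  by rewrite -ltnS ltn_ord.
(* Runs are numbered from the left by the descents before them; one position is picked in each of
   the runs 0 to [k]. *)
have gP (a : 'I_k.+1) : {y : 'I_M.+1 | ndes (word s) 0 y == a}.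
  apply: sigW; have [|y yM <-] := @ndes_surj (word s) M a.
    by apply: leq_trans kM; rewrite -ltnS.
  by exists (inord y); rewrite inordK.
pose g a := sval (gP a).
have gE a : ndes (word s) 0 (g a) = a by apply/eqP/(svalP (gP a)).
have inc (a b : 'I_k.+1) : a < b -> g a < g b.
  move=> ab; rewrite ltnNge; apply/negP => le.
  by have := @ndes_cat (word s) 0 (g b) (g a); rewrite le !gE => /(_ isT); lia.
have dec (a b : 'I_k.+1) : a < b -> s (g b) < s (g a).
  move=> ab; have gab := inc _ _ ab.
  have := lt0 (g a) (g b); rewrite gab !word_ord => /(_ (ltn_ord _)).
  have := @ndes_cat (word s) 0 (g a) (g b); rewrite (ltnW gab) !gE => /(_ isT) e.
  have ne : s (g a) != s (g b) :> nat.
    by rewrite val_eqE (inj_eq perm_inj) -val_eqE /=; lia.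
  lia.
exists g => // a b; rewrite decE; case: (ltngtP b a) => [/dec -> //|/dec h|/val_inj ->].
  by rewrite ltnNge (ltnW h).
by rewrite ltnn.
Qed.

(** By [lt_ndes0] the descents decide every comparison of two entries, and the comparisons determine
    the permutation. *)
Lemma word_descents_inj s t :
  centrally_symmetric s -> ~~ contains s pattern132 ->
  centrally_symmetric t -> ~~ contains t pattern132 ->
  (forall i, i < M -> (word s i.+1 < word s i) = (word t i.+1 < word t i)) -> s = t.
Proof.
move=> syms avs symt avt e.
have lt x y : x < y < M.+1 -> (word s x < word s y) = (word t x < word t y).
  move=> xy; rewrite (lt_ndes0 (@word_inj s) (elimT (word_132 s) avs) (word_213 syms avs)) //.
  rewrite (lt_ndes0 (@word_inj t) (elimT (word_132 t) avt) (word_213 symt avt)) //.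
  congr (_ == 0); apply: eq_big_nat => i /andP [_ iy]; rewrite e //; lia.
have mono (x y : 'I_M.+1) : (s x < s y) = (t x < t y).
  have := lt x y; have := lt y x; rewrite !word_ord !ltn_ord !andbT.
  case: (ltngtP x y) => [xy _ /(_ isT) -> //|yx /(_ isT) h _|/val_inj -> _ _]; last first.
    by rewrite !ltnn.
  have ne (u : 'S_M.+1) : u x != u y :> nat.
    by rewrite val_eqE (inj_eq perm_inj) -val_eqE gtn_eqF.
  move: (ne s) (ne t); lia.
(* A value is recovered as the number of smaller ones. *)
have cardE (u : 'S_M.+1) x : #|[set y | u y < u x]| = u x.
  rewrite -[RHS]card_ltn_ord -[RHS](card_preimset _ (@perm_inj _ u)).
  by apply: eq_card => y; rewrite !inE.
apply/permP => x; apply: val_inj; rewrite /= -(cardE s) -(cardE t).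
by apply: eq_card => y; rewrite !inE mono.
Qed.

End Word.

(** * Construction of a permutation with a given symmetric descent set *)

Section PrescribedDescents.
Variables (M : nat) (a : nat -> bool).
Hypothesis a_sym : forall i, i < M -> a (M - i.+1) = a i.

Let breaks (x y : nat) : nat := \sum_(x <= i < y) a i.

(* Sorting positions by this key reads the maximal break-free intervals from
   right to left, each one increasingly. *)
Let key (x : 'I_M.+1) : nat := x + M.+1 * breaks x M.

Let breaks_cat x y : x <= y <= M -> breaks x M = breaks x y + breaks y M.
Proof. by case/andP=> xy yM; rewrite /breaks (@big_cat_nat _ _ _ y). Qed.

(** A single break is worth [M.+1], more than any difference of positions. *)
Let key_lt (x y : 'I_M.+1) : x < y -> (key x < key y) = (breaks x y == 0).
Proof.
move=> xy; have yM := ltn_ord y; rewrite /key (@breaks_cat x y); last by lia.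
rewrite mulnDr; case: (breaks x y) => [|b] /=; first by rewrite muln0; lia.
by rewrite mulnS; move: (M.+1 * b) (M.+1 * _); lia.
Qed.

Let key_inj : injective key.
Proof.
move=> x y; rewrite /key => /(congr1 (modn^~ M.+1)); rewrite ![_ + M.+1 * _]addnC.
by rewrite ![M.+1 * _]mulnC !modnMDl !modn_small // => /val_inj.
Qed.

(** By symmetry of [a], the breaks to the right of [rev_ord x] are as many as those to the left of
    [x]. The sum being constant, [rev_ord] reverses the order of keys. *)
Let key_rev (x : 'I_M.+1) : key (rev_ord x) + key x = M + M.+1 * breaks 0 M.
Proof.
have xM : x <= M by rewrite -ltnS.
have -> : breaks 0 M = breaks (rev_ord x) M + breaks x M.
  rewrite (@breaks_cat 0 x) ?leq0n // /breaks; congr (_ + _).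
  rewrite /= subSS -[M - x]add0n big_addn subKn // big_nat_rev.
  apply: eq_big_nat => i /andP [_ ix]; rewrite -a_sym; last by lia.
  by congr (a _ : nat); lia.
rewrite /key /= subSS mulnDr; lia.
Qed.

Lemma prescribed_descents :
  exists s : 'S_M.+1, [/\ centrally_symmetric s, ~~ contains s pattern132
    & forall i, i < M -> (word s i.+1 < word s i) = a i].
Proof.
have rank_le x : rank key x < M.+1 by rewrite -[M.+1 in X in _ < X]card_ord rank_bound.
have rank_ord_inj : injective (fun x => Ordinal (rank_le x)).
  by move=> x y /(congr1 val) /= /(rank_inj key_inj).
pose s := perm rank_ord_inj; exists s.
have sE x y : (s x < s y) = (key x < key y).
  by rewrite !permE /= (rank_lt key_inj) ltEnat.
have wE x y : x < y <= M -> (word s x < word s y) = (breaks x y == 0).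
  by move=> xy; rewrite /word sE key_lt ?inordK //; lia.
split.
- apply/forallP => x; apply/eqP/val_inj; rewrite !permE /= subSS.
  have := rank_reverse key_inj x rev_ordK _; rewrite card_ord => h.
  apply/eqP; rewrite -(eqn_add2r (rank key x)) subnK; last exact: rank_le.
  apply/eqP/succn_inj/h => u v.
  by rewrite !ltEnat /=; move: (key_rev u) (key_rev v); lia.
(* In a 132 at [x], [y], [z], the ascent from [x] to [z] excludes breaks between them, hence also
   between [y] and [z], where the word would then increase. *)
- apply/word_132 => x y z /andP [xy yz] zM; apply/negP => /andP [xz zy].
  move: xz; rewrite wE ?(ltn_trans xy yz) // => b0.
  have : breaks y z = 0.
    move/eqP: b0; rewrite /breaks (@big_cat_nat _ _ _ y) ?(ltnW xy) ?(ltnW yz) //=; lia.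
  by move/eqP; rewrite -wE ?yz // => /ltnW; rewrite leqNgt zy.
- move=> i iM; have := wE i i.+1; rewrite iM ltnSn /breaks big_nat1 => /(_ isT).
  have : word s i != word s i.+1.
    by apply/eqP => /word_inj; rewrite !inE => e; have := e ltac:(lia) ltac:(lia); lia.
  by case: (a i) => /=; lia.
Qed.

End PrescribedDescents.

(** * Counting symmetric descent sets *)

Section DescentSets.
Variable m : nat.
Implicit Types (s : 'S_m.*2.+2) (A : {set 'I_m.+1}).

(* A symmetric descent set is recorded by the distances of the gaps to the
   central gap, which lies between positions m and m+1. *)
Definition half_descents s : {set 'I_m.+1} :=
  [set t : 'I_m.+1 | word s (m + t).+1 < word s (m + t)].

(** The size of the full symmetric gap set: the central gap is its own mirror image, every other gap
    comes with a distinct one. *)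
Definition weight A : nat := (ord0 \in A) + #|A :\ ord0|.*2.

Lemma descent_rev s i : centrally_symmetric s -> i < m.*2.+1 ->
  (word s (m.*2.+1 - i.+1).+1 < word s (m.*2.+1 - i.+1)) = (word s i.+1 < word s i).
Proof.
move=> sym iM; rewrite -subSn // subSS !(word_rev sym) ?(ltnW iM) //.
move: (word_le s i) (word_le s i.+1); lia.
Qed.

Lemma ndes_weight s : centrally_symmetric s ->
  ndes (word s) 0 m.*2.+1 = weight (half_descents s).
Proof.
move=> sym; set g := fun i => word s i.+1 < word s i; rewrite /weight.
have -> : #|half_descents s :\ ord0| = \sum_(0 <= i < m) g (i + m.+1).
  rewrite big_mkord -sum1_card big_mkcond big_ord_recl !inE eqxx /= add0n.
  apply: eq_bigr => i _; rewrite !inE /= /bump add1n addnS -addSn addnC /g.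
  by case: ltnP.
rewrite -[ndes _ _ _]/(\sum_(0 <= i < m.*2.+1) g i).
rewrite (@big_cat_nat _ _ _ m) /=; [|by []|by lia].
rewrite [X in _ + X]big_ltn; last by lia.
(* The gaps left of the centre are folded onto those to its right. *)
have -> : \sum_(0 <= i < m) g i = \sum_(0 <= i < m) g (i + m.+1).
  rewrite big_nat_rev; apply: eq_big_nat => i /andP [_ im].
  rewrite /g -descent_rev //; last by lia.
  by have -> : m.*2.+1 - (0 + m - i.+1).+1 = i + m.+1 by lia.
rewrite -[m.+1 in X in _ + (_ + X)]add0n big_addn.
have -> : m.*2.+1 - m.+1 = m by lia.
by rewrite inE /= addn0 -/(g m) -addnn; lia.
Qed.

(** The parity of [j] decides whether the central gap belongs to [A]; the rest of [A] is any set of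
    [j./2] among the [m] other distances. *)
Lemma card_weight j : #|[set A | weight A == j]| = 'C(m, j./2).
Proof.
pose f A := A :\ ord0.
have inj : {in [set A | weight A == j] &, injective f}.
  move=> A B; rewrite !inE /f => /eqP wA /eqP wB e; apply/setP => x.
  have [->|x0] := eqVneq x ord0.
    have : (ord0 \in A : nat) = (ord0 \in B); last by case: (_ \in A) (_ \in B) => [] [].
    by move: wA wB; rewrite /weight e; lia.
  by have /setP/(_ x) := e; rewrite !inE x0.
rewrite -(card_in_imset inj).
have -> : f @: [set A | weight A == j]
    = [set B : {set 'I_m.+1} | B \subset [set~ ord0] & #|B| == j./2].
  apply/setP => B; rewrite inE; apply/imsetP/andP.
    case=> A; rewrite inE /weight => /eqP <- ->; split.
      by rewrite /f setDE subsetIr.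
    by rewrite halfD odd_double andbF add0n doubleK; case: (_ \in _).
  case=> sB /eqP cB; have nB : ord0 \notin B.
    by apply/negP => /(subsetP sB); rewrite !inE eqxx.
  have B0 : B :\ ord0 = B by apply/setDidPl; rewrite disjoint_sym disjoints1.
  exists (if odd j then ord0 |: B else B); last by rewrite /f; case: odd; rewrite ?setU1K.
  rewrite inE /weight; have := odd_double_half j; rewrite -cB; case: (odd j) => <-.
    by rewrite setU1K // setU11.
  by rewrite (negbTE nB) B0.
by rewrite cards_draws cardsC1 card_ord.
Qed.

(** The index [j] is the weight plus one, that is, the number of runs. *)
Lemma card_weight_lt k :
  #|[set A | weight A < k]| = \sum_(1 <= j < k.+1) 'C(m, (j - 1) %/ 2).
Proof.
elim: k => [|k IH].
  by rewrite big_geq //; apply: eq_card0 => A; rewrite inE.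
rewrite big_nat_recr //= -IH subn1 divn2 -card_weight.
rewrite -[LHS](cardsID [set A | weight A < k]); congr (_ + _); apply: eq_card => A; rewrite !inE.
  by rewrite ltnS; case: (ltnP _ k) => [/ltnW ->|_]; rewrite ?andbT ?andbF.
by rewrite ltnS -leqNgt -eqn_leq eq_sym.
Qed.

(** [half_descents] is a bijection onto the sets of weight below [k]: injective by
    [word_descents_inj], surjective by [prescribed_descents]. *)
Lemma card_symmetric_avoiding k :
  #|[set s : 'S_m.*2.+2 | [&& centrally_symmetric s, ~~ contains s pattern132
       & ~~ contains s (decreasing_pattern k.+1)]]|
  = \sum_(1 <= j < k.+1) 'C(m, (j - 1) %/ 2).
Proof.
rewrite -card_weight_lt.
have weightE s : centrally_symmetric s -> ~~ contains s pattern132 ->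
    ~~ contains s (decreasing_pattern k.+1) = (weight (half_descents s) < k).
  by move=> sym av; rewrite contains_decreasing // ndes_weight // -ltnNge.
rewrite -(card_in_imset (f := half_descents)); last first.
  move=> s t; rewrite !inE => /and3P [syms avs _] /and3P [symt avt _] /setP e.
  apply: word_descents_inj => // i iM.
  (* [half_descents] sees only gaps from the centre rightwards; [descent_rev] carries the others
     there. *)
  wlog mi : i iM / m <= i => [wl|].
    have [/wl //|im] := leqP m i; first exact.
    by rewrite -(descent_rev syms iM) -(descent_rev symt iM) wl //; lia.
  have tP : i - m < m.+1 by lia.
  by have := e (Ordinal tP); rewrite !inE /= subnKC.
congr #|pred_of_set _|; apply/setP => A; rewrite inE; apply/imsetP/idP.
  by case=> s; rewrite inE => /and3P [sym av dec] ->; rewrite -weightE.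
(* With truncated subtraction, the sum is the distance from [i] to the central gap [m]. *)
move=> wA; pose a i := inord ((i - m) + (m - i)) \in A.
have [|s [sym av des]] := @prescribed_descents m.*2.+1 a.
  by move=> i iM; rewrite /a; congr (inord _ \in A); lia.
have e : half_descents s = A.
  apply/setP => t; rewrite inE des; last by move: (ltn_ord t); lia.
  by rewrite /a (_ : _ + _ = t) ?inord_val //; lia.
by exists s; rewrite // inE sym av weightE // e.
Qed.

End DescentSets.

(** * Increasing relabelling of [±n] by 0, ..., 2n-1 *)

Section Transport.
Variable m : nat.
Let n := m.+1.
Let N := m.*2.+2.

Lemma card_pm : #|{: pm n}| = N.
Proof.
rewrite card_seq_sub; first by rewrite size_cat !size_map !size_iota addnn.
rewrite cat_uniq !map_inj_uniq ?iota_uniq ?andbT.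
- apply/hasPn => x /mapP [i]; rewrite mem_iota => i1 ->; apply/mapP => -[j].
  by rewrite mem_iota; lia.
- by move=> i j [].
- by move=> i j /GRing.oppr_inj [].
Qed.

Lemma pm_opp_subproof (x : pm n) : (- val x)%R \in pm_seq n.
Proof. by have := valP x; rewrite !mem_pm_seq abszN. Qed.

Definition pm_opp (x : pm n) : pm n := SeqSub (pm_opp_subproof x).

Lemma pm_oppK : involutive pm_opp.
Proof. by move=> x; apply: val_inj; rewrite /= GRing.opprK. Qed.

Lemma pm_rank_subproof (x : pm n) : rank (val : pm n -> int) x < N.
Proof. by rewrite -card_pm rank_bound. Qed.

Definition pm_rank (x : pm n) : 'I_N := Ordinal (pm_rank_subproof x).

Lemma pm_rank_lt (x y : pm n) : (pm_rank x < pm_rank y) = (val x < val y)%R.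
Proof. by rewrite /= (rank_lt val_inj). Qed.

Lemma pm_rank_inj : injective pm_rank.
Proof. by move=> x y /(congr1 val) /(rank_inj val_inj). Qed.

Lemma pm_rank_opp (x : pm n) : pm_rank (pm_opp x) = rev_ord (pm_rank x).
Proof.
pose r := rank (val : pm n -> int).
have e : (r (pm_opp x) + r x).+1 = N.
  by rewrite -card_pm (rank_reverse val_inj _ pm_oppK) // => u v; rewrite Num.Theory.ltrN2.
by apply: val_inj; rewrite -[LHS]/(r (pm_opp x)) -[RHS]/(N - (r x).+1) -e subSS addnK.
Qed.

Lemma pm_rank_bij : bijective pm_rank.
Proof. by apply: inj_card_bij; [exact: pm_rank_inj | rewrite card_pm card_ord]. Qed.

(** [F] is conjugation by the order isomorphism [pm_rank], which turns negation into [rev_ord]. *)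
Lemma perm_transport : exists2 F : {perm pm n} -> 'S_N, bijective F
  & forall w x, F w (pm_rank x) = pm_rank (w x).
Proof.
have [g rK gK] := pm_rank_bij.
have inj1 (w : {perm pm n}) : injective (fun i => pm_rank (w (g i))).
  by move=> i j /pm_rank_inj /perm_inj /(can_inj gK).
have inj2 (s : 'S_N) : injective (fun x => g (s (pm_rank x))).
  by move=> x y /(can_inj gK) /perm_inj /pm_rank_inj.
exists (fun w => perm (inj1 w)); last by move=> w x; rewrite permE rK.
by exists (fun s => perm (inj2 s)) => w; apply/permP => x; rewrite !permE ?rK ?gK.
Qed.

Section Conjugate.
Variables (w : {perm pm n}) (s : 'S_N).
Hypothesis sw : forall x, s (pm_rank x) = pm_rank (w x).

Lemma signed_perm_transport : signed_perm w = centrally_symmetric s.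
Proof.
have opp_val (x y : pm n) : (val y == - val x)%R = (y == pm_opp x) by [].
have -> : signed_perm w = [forall x, w (pm_opp x) == pm_opp (w x)].
  apply/'forall_forallP/forallP => [h x|h x y].
    by have := h x (pm_opp x); rewrite !opp_val eqxx.
  by rewrite !opp_val; apply/implyP => /eqP ->.
have [g rK gK] := pm_rank_bij.
apply/forallP/forallP => [h i|h x].
  by rewrite -(gK i) -pm_rank_opp !sw -pm_rank_opp (eqP (h _)).
by rewrite -(inj_eq pm_rank_inj) -sw !pm_rank_opp -sw.
Qed.

Lemma globally_contains_transport k (p : 'S_k) : globally_contains w p = contains s p.
Proof.
have [g rK gK] := pm_rank_bij.
apply/existsP/containsP => [[i /andP [/'forall_forallP h1 /'forall_forallP h2]]|[i h1 h2]].
  exists (fun a => pm_rank (i a)) => a b; rewrite ?sw pm_rank_lt.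
    exact/implyP.
  exact: (eqP (h2 a b)).
exists [ffun a => g (i a)]; apply/andP; split; apply/'forall_forallP => a b;
  rewrite !ffunE -pm_rank_lt -?sw !gK ?h2 //.
exact/implyP/h1.
Qed.

End Conjugate.

End Transport.

Theorem theorem6p5 (k n : nat) (hk : 1 <= k) (hn : 1 <= n) :
  #|[set w in signed_perms n |
       globally_avoids w pattern132
       & globally_avoids w (decreasing_pattern k.+1)]|
  = \sum_(1 <= j < k.+1) 'C(n - 1, (j - 1) %/ 2).
Proof.
case: n hn => // m _; rewrite subn1 /= -card_symmetric_avoiding.
have [F F_bij FE] := perm_transport m.
rewrite -(on_card_preimset (onW_bij _ F_bij)); apply: eq_card => w.
(* The set to be counted is the preimage under [F] of the one counted by
   [card_symmetric_avoiding]. *)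
rewrite !inE (signed_perm_transport (FE w)) /globally_avoids.
by rewrite !(globally_contains_transport (FE w)).
Qed.
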